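(* Let $(X,\mu)$ be a non-atomic probability space equipped with a tree $\mathcal{T}$, with associated maximal operator $\mathcal{M}_{\mathcal{T}}$. Let $p>1$, $q\in(1,p)$, and let $f,F$ be real numbers with $0<f^p\le F$. Let $(\phi_n)_{n\in\mathbb{N}}$ be a sequence of non-negative $\mathcal{T}$-good functions satisfying $\int_X\phi_n\,d\mu=f$ and $\int_X\phi_n^p\,d\mu=F$ for every $n\in\mathbb{N}$. Let $\beta$ be defined by $$\beta+1=\omega_p\!\left(\frac{f^p}{F}\right).$$ Then $(\phi_n)_n$ satisfies equality in the limit in the inequality $$\int_X(\mathcal{M}_{\mathcal{T}}\phi)^p\,d\mu\ \le\ -\frac{q(\beta+1)}{(p-1)q\beta+(p-q)}\,f^p+\frac{p(\beta+1)^q}{(p-1)q\beta+(p-q)}\int_X\phi^q(\mathcal{M}_{\mathcal{T}}\phi)^{p-q}\,d\mu ,$$ that is, $$\lim_{n\to\infty}\left[-\frac{q(\beta+1)}{(p-1)q\beta+(p-q)}\,f^p+\frac{p(\beta+1)^q}{(p-1)q\beta+(p-q)}\int_X\phi_n^q(\mathcal{M}_{\mathcal{T}}\phi_n)^{p-q}\,d\mu-\int_X(\mathcal{M}_{\mathcal{T}}\phi_n)^p\,d\mu\right]=0,$$ if and only if $$\lim_{n\to\infty}\int_X\left|\mathcal{M}_{\mathcal{T}}\phi_n-(\beta+1)\phi_n\right|^p d\mu=0 .$$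
   Context: Let $(X,\mu)$ be a non-atomic probability space. A set $\mathcal{T}$ of measurable subsets of $X$ is called a tree if: (i) $X\in\mathcal{T}$ and $\mu(I)>0$ for every $I\in\mathcal{T}$; (ii) to every $I\in\mathcal{T}$ there corresponds a finite or countable subset $C(I)\subseteq\mathcal{T}$ containing at least two elements, such that the elements of $C(I)$ are pairwise disjoint subsets of $I$ and $I=\bigcup C(I)$; (iii) $\mathcal{T}=\bigcup_{m\ge0}\mathcal{T}_{(m)}$, where $\mathcal{T}_{(0)}=\{X\}$ and $\mathcal{T}_{(m+1)}=\bigcup_{I\in\mathcal{T}_{(m)}}C(I)$; (iv) $\lim_{m\to\infty}\sup_{I\in\mathcal{T}_{(m)}}\mu(I)=0$; (v) $\mathcal{T}$ differentiates $L^1(X,\mu)$, i.e. for every $\phi\in L^1(X,\mu)$, for $\mu$-almost every $x\in X$, $\frac{1}{\mu(I)}\int_I\phi\,d\mu\to\phi(x)$ as $\mu(I)\to0$ with $x\in I\in\mathcal{T}$. The associated maximal operator is $\mathcal{M}_{\mathcal{T}}\phi(x)=\sup\left\{\frac{1}{\mu(I)}\int_I|\phi|\,d\mu:\ x\in I\in\mathcal{T}\right\}$ for $\phi\in L^1(X,\mu)$. For non-negative $\phi\in L^1(X,\mu)$ and $I\in\mathcal{T}$ put $\mathrm{Av}_I(\phi)=\frac{1}{\mu(I)}\int_I\phi\,d\mu$. The function $\phi$ is called $\mathcal{T}$-good if the set $\{x\in X:\ \mathcal{M}_{\mathcal{T}}\phi(x)>\mathrm{Av}_I(\phi)\text{ for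 all }I\in\mathcal{T}\text{ such that }x\in I\}$ has $\mu$-measure zero. The function $\omega_p:[0,1]\to\left[1,\frac{p}{p-1}\right]$ is $\omega_p=H_p^{-1}$, the inverse of the decreasing bijection $H_p:\left[1,\frac{p}{p-1}\right]\to[0,1]$, $H_p(z)=-(p-1)z^p+pz^{p-1}$. *)

(* Defs.v *)
From HB Require Import structures.
From mathcomp Require Import all_boot all_order all_algebra.
From mathcomp Require Import all_classical all_reals all_analysis.

Set Implicit Arguments.
Unset Strict Implicit.
Unset Printing Implicit Defensive.

Import Order.TTheory GRing.Theory Num.Theory.
Import numFieldNormedType.Exports.

Local Open Scope classical_set_scope.
Local Open Scope ring_scope.
Local Open Scope ereal_scope.

Definition non_atomic (R : realType) (d : measure_display)
    (X : measurableType d) (mu : {measure set X -> \bar R}) : Prop :=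
  forall A : set X, measurable A -> 0 < mu A ->
    exists B : set X, [/\ measurable B, B `<=` A, 0 < mu B & mu B < mu A].

Definition average (R : realType) (d : measure_display)
    (X : measurableType d) (mu : {measure set X -> \bar R})
    (phi : X -> R) (I : set X) : \bar R :=
  (mu I)^-1 * \int[mu]_(x in I) (phi x)%:E.

Fixpoint tree_level (X : Type) (C : set X -> set (set X)) (m : nat) :
    set (set X) :=
  if m is m'.+1 then \bigcup_(I in tree_level C m') C I else [set setT].

Definition differentiates_L1 (R : realType) (d : measure_display)
    (X : measurableType d) (mu : {measure set X -> \bar R})
    (T : set (set X)) : Prop :=
  forall phi : X -> R, mu.-integrable setT (EFin \o phi) ->
    {ae mu, forall x, forall e : R, (0 < e)%R ->
      exists2 delta : R, (0 < delta)%R &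
        forall I : set X, T I -> I x -> mu I < delta%:E ->
          `|average mu phi I - (phi x)%:E| < e%:E}.

(* C I is the family of children of I. *)
Record tree_children (R : realType) (d : measure_display)
    (X : measurableType d) (mu : {measure set X -> \bar R})
    (T : set (set X)) (C : set X -> set (set X)) : Prop := TreeChildren {
  children_tree : forall I, T I -> C I `<=` T ;
  children_countable : forall I, T I -> countable (C I) ;
  children_two : forall I, T I -> exists J K, [/\ C I J, C I K & J <> K] ;
  children_disjoint : forall I, T I -> trivIset (C I) id ;
  children_cover : forall I, T I -> \bigcup_(J in C I) J = I ;
  tree_levels : T = \bigcup_m tree_level C m ;
  tree_mesh : ereal_sup [set mu I | I in tree_level C m] @[m --> \oo] --> 0
}.

Record is_tree (R : realType) (d : measure_display)
    (X : measurableType d) (mu : {measure set X -> \bar R})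
    (T : set (set X)) : Prop := IsTree {
  tree_measurable : forall I, T I -> measurable I ;
  tree_setT : T setT ;
  tree_gt0 : forall I, T I -> 0 < mu I ;
  tree_has_children : exists C, tree_children mu T C ;
  tree_differentiates : differentiates_L1 mu T
}.

Definition maximal (R : realType) (d : measure_display)
    (X : measurableType d) (mu : {measure set X -> \bar R})
    (T : set (set X)) (phi : X -> R) (x : X) : \bar R :=
  ereal_sup [set average mu (fun y => `|phi y|%R) I | I in [set I | T I /\ I x]].

(* Used only for nonnegative integrable phi, for which the set below is
   measurable: trees are countable. *)
Definition tree_good (R : realType) (d : measure_display)
    (X : measurableType d) (mu : {measure set X -> \bar R})
    (T : set (set X)) (phi : X -> R) : Prop :=
  mu.-negligible
    [set x | forall I, T I -> I x -> average mu phi I < maximal mu T phi x].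

Definition Hfun (R : realType) (p z : R) : R :=
  (- (p - 1) * z `^ p + p * z `^ (p - 1))%R.

(* For 1 < p, Hfun p is a decreasing bijection from [1, p / (p - 1)] onto [0, 1];
   omega p is its inverse, and is meaningful only on [0, 1]. *)
Definition omega (R : realType) (p : R) : R -> R :=
  'pinv_(fun=> 0%R) `[1%R, (p / (p - 1))%R]%classic (Hfun p).

(* Main.v *)
Require Import Defs.
From HB Require Import structures.
From mathcomp Require Import all_boot all_order all_algebra.
From mathcomp Require Import all_classical all_reals all_analysis.
From mathcomp Require Import measurable_realfun.
From mathcomp Require Import ring lra.
Set Implicit Arguments.
Unset Strict Implicit.
Unset Printing Implicit Defensive.
Import Order.TTheory GRing.Theory Num.Theory.
Import numFieldNormedType.Exports.
Local Open Scope classical_set_scope.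
Local Open Scope ring_scope.

(** Write M for the maximal function of a nonnegative phi, z = beta + 1,
    D = (p - 1) q beta + (p - q), and
      A = int phi M^(p-1),  B = int M^p,  J = int phi^q M^(p-q).
    The quantity whose limit is studied is the deficit
      e = - (q z / D) f^p + (p z^q / D) J - B.

    Two inequalities produce it.  The averages of phi over the levels of the
    tree form a martingale whose running maximum increases to M, and the
    Azema-Yor argument gives
      f^p + (p - 1) B <= p A                          [doob_maximal].
    On the other hand Bernoulli's inequality k(u) := u^q - 1 - q (u - 1) >= 0,
    taken at u = z phi / M, multiplied by M^p and integrated, reads
      int M^p k(u) = z^q J + (q - 1) B - q z A >= 0.
    Eliminating A leaves 0 <= int M^p k(u) <= (D / p) e.  Hence if e tends to 0
    along a sequence, so does int M^p k(u).  Now k vanishes at 1 only, and u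
    stays in the compact interval [0, z] because phi <= M almost everywhere
    [le_maximal_ae]; so for every eps there is a C with
    |u - 1|^p <= eps + C k(u) [dominated_off_one].  Since
    M^p |u - 1|^p = |M - z phi|^p and B is bounded in terms of p and F only,
    the distance int |M - z phi|^p tends to 0.

    Conversely, H_p(z) = f^p / F says that q z f^p = (p - D) z^p F, and
    z^p F = int M^p u^p, so that
      D e = int M^p (p u^q - D - (p - D) u^p).
    The bracket vanishes at u = 1, hence on [0, z] it is at most
    eps + C |u - 1|^p in absolute value, and e tends to 0 with the distance.
    Both implications are read off from the two estimates of
    [deficit_estimates], whose constants do not depend on phi. *)

(** * Power inequalities *)

Lemma powR_le (R : realType) (r x y : R) :
  0 <= r -> 0 <= x -> x <= y -> x `^ r <= y `^ r.
Proof.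
move=> r0 x0 xy; apply: ge0_ler_powR => //; rewrite nnegrE //.
exact: le_trans xy.
Qed.

(** The graph of x ^ p lies above its tangent at y.  This is Young's
    inequality for x and y ^ (p - 1), which covers x = 0 and y = 0. *)
Lemma powR_tangent (R : realType) (p x y : R) : 1 < p -> 0 <= x -> 0 <= y ->
  p * (x * y `^ (p - 1)) <= x `^ p + (p - 1) * y `^ p.
Proof.
move=> p1 x0 y0.
have p0 : 0 < p by lra.
have pB1 : 0 < p - 1 by lra.
have q0 : 0 < p / (p - 1) by rewrite divr_gt0.
have pq : p^-1 + (p / (p - 1))^-1 = 1 by field; lra.
have := conjugate_powR x0 (powR_ge0 y (p - 1)) p0 q0 pq.
rewrite -powRrM (_ : (p - 1) * (p / (p - 1)) = p); last by field; lra.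
rewrite -(ler_pM2l p0) => /le_trans; apply.
by rewrite le_eqVlt; apply/orP; left; apply/eqP; field; lra.
Qed.

Lemma bernoulli_powR (R : realType) (q u : R) : 1 < q -> 0 <= u ->
  1 + q * (u - 1) <= u `^ q.
Proof.
move=> q1 u0; have := powR_tangent q1 u0 ler01.
rewrite !powR1; lra.
Qed.

(** A quantitative form of strictness in Bernoulli's inequality.  Put
    v = sqrt u: when 1 + q (v - 1) >= 0, squaring Bernoulli's inequality for v
    gains the term q (q - 1) (v - 1)^2; otherwise v < 1 - 1 / q, and u ^ q >= 0
    already suffices. *)
Lemma bernoulli_gap (R : realType) (q u : R) : 1 < q -> 0 <= u ->
  (q - 1) * (Num.sqrt u - 1) ^+ 2 <= u `^ q - 1 - q * (u - 1).
Proof.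
move=> q1 u0; set v := Num.sqrt u.
have v0 : 0 <= v by exact: sqrtr_ge0.
have uv : u = v ^+ 2 by rewrite sqr_sqrtr.
have uq : u `^ q = (v `^ q) ^+ 2.
  by rewrite -powR_mulrn ?powR_ge0// -powRrM mulrC powRrM powR_mulrn// -uv.
have := bernoulli_powR q1 v0; rewrite uq uv.
have := powR_ge0 v q; set t := v `^ q => t0 ht.
have [h|h] := leP 0 (1 + q * (v - 1)).
  have : (1 + q * (v - 1)) ^+ 2 <= t ^+ 2 by rewrite lerXn2r ?nnegrE.
  have : 0 <= (q - 1) * (q - 1) * (v - 1) ^+ 2.
    by rewrite mulr_ge0 ?sqr_ge0// mulr_ge0; lra.
  rewrite !expr2; nra.
have v1 : v < 1 by nra.
have : 0 <= t ^+ 2 by exact: sqr_ge0.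
(* With w = 1 - v, the difference to be shown nonnegative is t^2 plus
   2 q w - 1 - q w^2 - (q - 1) w^2, which is the sum of these two products. *)
have : 0 <= v * (-(1 + q * (v - 1))) by rewrite mulr_ge0//; lra.
have : 0 <= (q - 1) * v * (1 - v) by rewrite !mulr_ge0//; lra.
rewrite !expr2; nra.
Qed.

(** Young's inequality with a small constant in front of m ^ p.  It follows by
    comparing a with e * m, and serves to absorb the integral of M ^ p in Doob's
    inequality. *)
Lemma powR_young (R : realType) (p e a m : R) : 1 < p -> 0 < e -> 0 <= a ->
  0 <= m ->
  a * m `^ (p - 1) <= e * m `^ p + e `^ (1 - p) * a `^ p.
Proof.
move=> p1 e0 a0 m0; have p0 : 0 < p by lra.
rewrite -(mulr_powRB1 m0 p0) -(mulr_powRB1 a0 p0).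
have [aem|ema] := leP a (e * m).
  apply: (@le_trans _ _ (e * (m * m `^ (p - 1)))).
    by rewrite mulrA ler_wpM2r ?powR_ge0.
  by rewrite lerDl !mulr_ge0 ?powR_ge0.
apply: (@le_trans _ _ (e `^ (1 - p) * (a * a `^ (p - 1)))); last first.
  by rewrite lerDr !mulr_ge0 ?powR_ge0// ltW.
rewrite mulrCA ler_wpM2l//.
have -> : 1 - p = - (p - 1) by ring.
rewrite powRN ler_pdivlMl ?powR_gt0// -powRM ?(ltW e0)//.
by rewrite powR_le ?mulr_ge0//; lra.
Qed.

(** * Domination away from a single zero *)

(** Near 1 the function r is below e by continuity; elsewhere w is bounded
    below, and the bounded r is absorbed by a multiple of w. *)
Lemma dominated_off_one (R : realType) (r w : R -> R) (z K : R) :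
  {for 1, continuous r} -> r 1 = 0 ->
  (forall u : R, 0 <= u <= z -> `|r u| <= K) ->
  (forall u : R, 0 <= u <= z -> 0 <= w u) ->
  (forall e : R, 0 < e -> exists2 c : R, 0 < c &
    forall u : R, 0 <= u <= z -> e <= `|u - 1| -> c <= w u) ->
  forall e : R, 0 < e -> exists2 C : R, 0 <= C &
    forall u : R, 0 <= u <= z -> `|r u| <= e + C * w u.
Proof.
move=> rc r1 rK w0 wc e e0.
have /cvgrPdist_le /(_ _ e0) /= := rc; rewrite r1 => -[h /= h0 hr].
have [c c0 cw] := wc _ h0.
exists (`|K| / c); first by rewrite divr_ge0// ltW.
move=> u uz; have [uh|hu] := ltP `|u - 1| h.
  have /hr : ball_ [eta Num.Def.normr] 1 h u by rewrite /ball_/= distrC.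
  rewrite sub0r normrN => /le_trans; apply.
  by rewrite lerDl mulr_ge0 ?w0// divr_ge0// ltW.
apply: (@le_trans _ _ (`|K| / c * c)).
  by rewrite divfK ?gt_eqF//; apply: le_trans (ler_norm K); exact: rK.
apply: (@le_trans _ _ (`|K| / c * w u)); last by rewrite lerDr ltW.
by rewrite ler_wpM2l ?divr_ge0 ?(ltW c0)// cw.
Qed.

Lemma cvg0_dominated (R : realType) (x y : nat -> R) :
  y n @[n --> \oo] --> (0 : R) ->
  (forall e : R, 0 < e -> exists2 C : R, 0 <= C &
    forall n, `|x n| <= e + C * `|y n|) ->
  x n @[n --> \oo] --> (0 : R).
Proof.
move=> y0 xy; apply/cvgrPdist_le => /= e e0.
have e20 : 0 < e / 2 by rewrite divr_gt0.
have [C C0 xyC] := xy _ e20.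
have eC0 : 0 < e / 2 / (C + 1) by rewrite divr_gt0//; lra.
have /cvgrPdist_le /(_ _ eC0) /= := y0; apply: filterS => n.
rewrite !sub0r !normrN => yn; apply: le_trans (xyC n) _.
suff : C * `|y n| <= e / 2 by lra.
apply: (@le_trans _ _ ((C + 1) * (e / 2 / (C + 1)))).
  by apply: ler_pM => //; lra.
by rewrite mulrC divfK//; lra.
Qed.

Lemma continuous_powR (R : realType) (a x : R) : 0 < x ->
  {for x, continuous (fun u : R => u `^ a)}.
Proof.
move=> x0; apply: differentiable_continuous; apply/derivable1_diffP.
by apply: derivable_powR; rewrite in_itv/= x0.
Qed.

Lemma continuous_normB1_powR (R : realType) (p : R) : 1 < p ->
  {for 1, continuous (fun u : R => `|u - 1| `^ p)}.
Proof.
move=> p1; have p0 : p != 0 by rewrite gt_eqF// (lt_trans ltr01).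
apply/cvgrPdist_le => /= e e0.
have m0 : 0 < Num.min e 1 by rewrite lt_min e0 ltr01.
exists (Num.min e 1) => //= u; rewrite subrr normr0 powR0//.
rewrite sub0r normrN (ger0_norm (powR_ge0 _ _)).
rewrite /ball_/= distrC lt_min => /andP[ue u1].
have [->|u0] := eqVneq `|u - 1| 0.
  by rewrite powR0 ?(ltW e0).
apply: le_trans (ltW ue); apply: ge1r_powR; last exact: ltW.
by rewrite lt_neqAle eq_sym u0 normr_ge0 ltW.
Qed.

(** Since u - 1 = (sqrt u - 1) (sqrt u + 1), the bound in sqrt u turns into one
    in u, uniformly on [0, z]. *)
Lemma bernoulli_gap_off_one (R : realType) (q z e : R) : 1 < q -> 0 < e ->
  exists2 c : R, 0 < c & forall u : R, 0 <= u <= z -> e <= `|u - 1| ->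
    c <= u `^ q - 1 - q * (u - 1).
Proof.
move=> q1 e0; pose b := Num.sqrt z + 1.
have b0 : 0 < b by rewrite /b ltr_wpDl// sqrtr_ge0.
exists ((q - 1) * (e / b) ^+ 2).
  by rewrite mulr_gt0 ?exprn_gt0 ?divr_gt0// subr_gt0.
move=> u /andP[u0 uz] eu; apply: le_trans (bernoulli_gap q1 u0).
rewrite ler_pM2l ?subr_gt0// -[leRHS]real_normK ?num_real//.
rewrite lerXn2r ?nnegrE ?divr_ge0 ?(ltW e0) ?(ltW b0)//.
rewrite ler_pdivrMr//; apply: le_trans eu _.
have {1}-> : u = Num.sqrt u ^+ 2 by rewrite sqr_sqrtr.
rewrite -[X in _ - X](expr1n _ 2) subr_sqr normrM ler_wpM2l//.
rewrite ger0_norm ?addr_ge0 ?sqrtr_ge0// /b lerD2r.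
by rewrite ler_wsqrtr.
Qed.

(** * Averages over countable partitions *)

(** A countable partition of X is encoded by an index function X -> nat, whose
    nonempty fibres are the atoms; the atoms are then disjoint and covering by
    construction. *)
Local Notation atom g x := (g @^-1` [set g x]).

(** Measurability with respect to the partition, as mere constancy on atoms. *)
Definition determined_by (X Y : Type) (idx : X -> nat) (h : X -> Y) : Prop :=
  forall x y, idx x = idx y -> h x = h y.

Lemma measurable_determined (R : realType) (d : measure_display)
    (X : measurableType d) (idx : X -> nat) (h : X -> R) :
  measurable_fun setT idx -> determined_by idx h -> measurable_fun setT h.
Proof.
move=> midx hidx _ Y mY; rewrite setTI.
have -> : h @^-1` Y = setT `&` idx @^-1` (idx @` (h @^-1` Y)).
  rewrite setTI; apply/seteqP; split=> [x Yx|x [y Yy /hidx]]; first by exists x.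
  by rewrite /preimage/= => <-.
exact: midx.
Qed.

(** The conditional expectation property of the averages E of phi over the
    atoms, tested against a nonnegative function h of the partition: both sides
    split into a sum over the atoms, on which E and h are constant. *)
Lemma tower_property (R : realType) (d : measure_display)
    (X : measurableType d) (mu : {measure set X -> \bar R}) (idx : X -> nat)
    (phi E h : X -> R) :
  measurable_fun setT idx -> measurable_fun setT phi ->
  (forall x, 0 <= phi x) -> (forall x, 0 <= E x) -> (forall x, 0 <= h x) ->
  determined_by idx E -> determined_by idx h ->
  (forall x, (\int[mu]_(y in atom idx x) (phi y)%:E =
    (E x)%:E * mu (atom idx x))%E) ->
  (\int[mu]_x (E x * h x)%:E = \int[mu]_x (phi x * h x)%:E)%E.
Proof.
move=> midx mphi phi0 E0 h0 Eidx hidx Ephi.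
have mF k : measurable (idx @^-1` [set k]).
  by rewrite -[X in measurable X]setTI; exact: midx.
have mE := measurable_determined midx Eidx.
have mh := measurable_determined midx hidx.
have cover : setT = \bigcup_k (idx @^-1` [set k]).
  by apply/seteqP; split=> // x _; exists (idx x).
have disj : trivIset setT (fun k => idx @^-1` [set k]).
  by move=> i j _ _ [x [/= <- <-]].
rewrite cover !ge0_integral_bigcup//=; last 4 first.
- rewrite -cover; apply/measurable_EFinP; exact: measurable_funM.
- by move=> x _; rewrite lee_fin mulr_ge0.
- rewrite -cover; apply/measurable_EFinP; exact: measurable_funM.
- by move=> x _; rewrite lee_fin mulr_ge0.
apply: eq_eseriesr => k _.
have [[x xk]|nk] := pselect (exists x, idx x = k); last first.
  have -> : idx @^-1` [set k] = set0.
    by apply/seteqP; split=> // x /= xk; apply: nk; exists x.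
  by rewrite !integral_set0.
rewrite -xk.
set F := atom idx x.
have mFx : measurable F by exact: mF.
have onF y : F y -> E y = E x /\ h y = h x.
  by move=> Fy; split; [exact: Eidx|exact: hidx].
transitivity (\int[mu]_(y in F) ((h x)%:E * (phi y)%:E))%E; last first.
  by apply: eq_integral => y /set_mem /onF [_ ->]; rewrite -EFinM mulrC.
rewrite ge0_integralZl_EFin//; last 2 first.
- by move=> y _; rewrite lee_fin.
- by apply/measurable_EFinP; exact: measurable_funTS.
rewrite Ephi muleA -EFinM mulrC -integral_cst//.
by apply: eq_integral => y /set_mem /onF [-> ->].
Qed.

Lemma ge0_integral_lin2 (R : realType) (d : measure_display)
    (X : measurableType d) (mu : {measure set X -> \bar R}) (a b : R)
    (u v : X -> R) (U V : R) :
  0 <= a -> 0 <= b -> measurable_fun setT u -> measurable_fun setT v ->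
  (forall x, 0 <= u x) -> (forall x, 0 <= v x) ->
  (\int[mu]_x (u x)%:E = U%:E)%E -> (\int[mu]_x (v x)%:E = V%:E)%E ->
  (\int[mu]_x (a * u x + b * v x)%:E = (a * U + b * V)%:E)%E.
Proof.
move=> a0 b0 mu_ mv u0 v0 iu iv.
under eq_integral do rewrite EFinD !EFinM.
rewrite ge0_integralD//; last 4 first.
- by move=> x _; rewrite -EFinM lee_fin mulr_ge0.
- by apply/measurable_EFinP; exact: measurable_funM.
- by move=> x _; rewrite -EFinM lee_fin mulr_ge0.
- by apply/measurable_EFinP; exact: measurable_funM.
rewrite !ge0_integralZl_EFin//; last 4 first.
- by move=> x _; rewrite lee_fin.
- exact/measurable_EFinP.
- by move=> x _; rewrite lee_fin.
- exact/measurable_EFinP.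
by rewrite iu iv.
Qed.

(** * Doob's inequality in Azema-Yor form *)

(** This makes p a m^(p-1) - (p-1) m^p a submartingale, where a is the current
    value and m the running maximum: nothing changes unless the maximum jumps to
    a, and then the tangent inequality at m applies.  The truncation at N
    preserves the inequality and makes all integrals finite beforehand. *)
Lemma azema_yor_step_trunc (R : realType) (p N a m : R) : 1 < p -> 0 <= a ->
  0 <= m -> 0 <= N ->
  p * (a * Num.min m N `^ (p - 1)) + (p - 1) * Num.min (Num.max m a) N `^ p <=
  p * (a * Num.min (Num.max m a) N `^ (p - 1)) + (p - 1) * Num.min m N `^ p.
Proof.
move=> p1 a0 m0 N0; have [//|ma] := leP a m.
have [Nm|mN] := leP N m.
  by rewrite (min_idPr _) ?(le_trans Nm (ltW ma)).
set b := Num.min a N.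
have b0 : 0 <= b by rewrite /b le_min a0.
have ba : b <= a by rewrite /b ge_min lexx.
have mb : m <= b by rewrite /b le_min !ltW.
have pm : m `^ (p - 1) <= b `^ (p - 1) by rewrite powR_le//; lra.
have := powR_tangent p1 b0 m0.
have : p * (b * b `^ (p - 1)) = p * b `^ p by rewrite mulr_powRB1//; lra.
have : 0 <= p * ((a - b) * (b `^ (p - 1) - m `^ (p - 1))).
  by rewrite !mulr_ge0 ?subr_ge0//; lra.
lra.
Qed.

Fixpoint running_max (R : realType) (X : Type) (E : nat -> X -> R) (n : nat) :
    X -> R :=
  if n is n'.+1 then fun x => Num.max (running_max E n' x) (E n x) else E 0.

Section running_max_theory.
Context (R : realType) (X : Type) (E : nat -> X -> R).

Lemma running_max_ge n x : E n x <= running_max E n x.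
Proof. by case: n => [//|n] /=; rewrite le_max lexx orbT. Qed.

Lemma running_max_homo x : nondecreasing_seq (running_max E ^~ x).
Proof. by apply/nondecreasing_seqP => n /=; rewrite le_max lexx. Qed.

Lemma running_max_le x (M : R) n : (forall k, E k x <= M) ->
  running_max E n x <= M.
Proof.
by move=> EM; elim: n => [|n ih] /=; [exact: EM|rewrite ge_max ih EM].
Qed.

Lemma determined_running_max (idx : nat -> X -> nat) n :
  (forall m, determined_by (idx m.+1) (idx m)) ->
  (forall m, determined_by (idx m) (E m)) ->
  determined_by (idx n) (running_max E n).
Proof.
move=> refine Eidx; elim: n => [|n ih] x y xy /=; first exact: Eidx.
by rewrite (ih x y) ?(Eidx _ _ _ xy)//; exact: refine.
Qed.

End running_max_theory.

Section doob.
Context (R : realType) (d : measure_display) (X : measurableType d).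
Variables (mu : probability X R) (idx : nat -> X -> nat) (E : nat -> X -> R).
Variables (phi : X -> R) (p f F : R).
Hypotheses (midx : forall m, measurable_fun setT (idx m))
  (refine : forall m, determined_by (idx m.+1) (idx m))
  (Eidx : forall m, determined_by (idx m) (E m))
  (E0 : forall m x, 0 <= E m x) (Einit : forall x, E 0%N x = f)
  (mphi : measurable_fun setT phi) (phi0 : forall x, 0 <= phi x)
  (Ephi : forall m x, (\int[mu]_(y in atom (idx m) x) (phi y)%:E =
    (E m x)%:E * mu (atom (idx m) x))%E)
  (p1 : 1 < p) (f0 : 0 < f)
  (phi_int : (\int[mu]_x (phi x)%:E = f%:E)%E)
  (phi_int_p : (\int[mu]_x ((phi x) `^ p)%:E = F%:E)%E).

Let p_gt0 : 0 < p. Proof. exact: lt_trans p1. Qed.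

Let pB1_gt0 : 0 < p - 1. Proof. by rewrite subr_gt0. Qed.

Definition trunc_max (N : R) n x := Num.min (running_max E n x) N.

Lemma running_max_ge0 n x : 0 <= running_max E n x.
Proof. exact: le_trans (running_max_ge E n x). Qed.

Lemma trunc_max_ge0 N n x : 0 <= N -> 0 <= trunc_max N n x.
Proof. by move=> N0; rewrite le_min running_max_ge0. Qed.

Lemma determined_trunc_max N n : determined_by (idx n) (trunc_max N n).
Proof.
move=> x y xy; rewrite /trunc_max.
by rewrite (determined_running_max refine Eidx xy).
Qed.

Lemma measurable_trunc_max N n : measurable_fun setT (trunc_max N n).
Proof. exact: measurable_determined (midx n) (@determined_trunc_max N n). Qed.

Lemma measurable_trunc_max_powR N n r :
  measurable_fun setT (fun x => trunc_max N n x `^ r).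
Proof.
exact: (measurableT_comp (measurable_powR r) (measurable_trunc_max N n)).
Qed.

Lemma integral_phi_trunc N n r :
  (\int[mu]_x (E n x * trunc_max N n x `^ r)%:E =
   \int[mu]_x (phi x * trunc_max N n x `^ r)%:E)%E.
Proof.
apply: (@tower_property _ _ _ mu (idx n)) => //.
- by move=> x; exact: powR_ge0.
- by move=> x y /determined_trunc_max ->.
Qed.

Definition trunc_pow N n := fine (\int[mu]_x (trunc_max N n x `^ p)%:E).
Definition trunc_cross N n :=
  fine (\int[mu]_x (phi x * trunc_max N n x `^ (p - 1))%:E).

Lemma integral_trunc_pow N n : 0 <= N ->
  (\int[mu]_x (trunc_max N n x `^ p)%:E = (trunc_pow N n)%:E)%E.
Proof.
move=> N0; rewrite fineK// ge0_fin_numE; last first.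
  by apply: integral_ge0 => x _; rewrite lee_fin powR_ge0.
apply: (@le_lt_trans _ _ (\int[mu]_x (cst (N `^ p)%:E x))%E).
  apply: ge0_le_integral => //.
  - by move=> x _; rewrite lee_fin powR_ge0.
  - by apply/measurable_EFinP; exact: measurable_trunc_max_powR.
  - move=> x _; rewrite lee_fin.
    apply: powR_le; [exact: ltW|exact: trunc_max_ge0|].
    by rewrite /trunc_max ge_min lexx orbT.
by rewrite integral_cst// [X in (_ * X)%E](probability_setT mu) mule1 ltry.
Qed.

Lemma integral_trunc_cross N n : 0 <= N ->
  (\int[mu]_x (phi x * trunc_max N n x `^ (p - 1))%:E = (trunc_cross N n)%:E)%E.
Proof.
move=> N0; rewrite fineK// ge0_fin_numE; last first.
  by apply: integral_ge0 => x _; rewrite lee_fin mulr_ge0 ?powR_ge0.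
apply: (@le_lt_trans _ _ (\int[mu]_x ((N `^ (p - 1))%:E * (phi x)%:E))%E).
  apply: ge0_le_integral => //.
  - by move=> x _; rewrite lee_fin mulr_ge0 ?powR_ge0.
  - apply/measurable_EFinP; apply: measurable_funM => //.
    exact: measurable_trunc_max_powR.
  - by apply/measurable_EFinP; exact: measurable_funM.
  - move=> x _; rewrite -EFinM lee_fin mulrC ler_wpM2r//.
    apply: powR_le; [exact: ltW|exact: trunc_max_ge0|].
    by rewrite /trunc_max ge_min lexx orbT.
rewrite ge0_integralZl_EFin//; last 3 first.
- by move=> x _; rewrite lee_fin.
- exact/measurable_EFinP.
- exact: powR_ge0.
by rewrite phi_int -EFinM ltry.
Qed.

(** Both truncated maxima are constant on the atoms of level n.+1, so phi may be
    replaced by E n.+1 under the integral; then the inequality holds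
    pointwise. *)
Lemma trunc_step N n : 0 <= N ->
  p * trunc_cross N n + (p - 1) * trunc_pow N n.+1 <=
  p * trunc_cross N n.+1 + (p - 1) * trunc_pow N n.
Proof.
move=> N0.
have p0 := ltW p_gt0; have pB0 := ltW pB1_gt0.
have mT k r := measurable_trunc_max_powR N k r.
have mE k := measurable_determined (midx k) (Eidx (m := k)).
have T0 k r x : 0 <= trunc_max N k x `^ r := powR_ge0 _ _.
have step0 : (\int[mu]_x (E n.+1 x * trunc_max N n x `^ (p - 1))%:E =
    (trunc_cross N n)%:E)%E.
  rewrite -integral_trunc_cross//.
  apply: (@tower_property _ _ _ mu (idx n.+1)) => //.
  by move=> x y /refine /determined_trunc_max ->.
have step1 : (\int[mu]_x (E n.+1 x * trunc_max N n.+1 x `^ (p - 1))%:E =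
    (trunc_cross N n.+1)%:E)%E.
  by rewrite -integral_trunc_cross// integral_phi_trunc.
have sum0 := ge0_integral_lin2 p0 pB0 (measurable_funM (mE n.+1) (mT n _))
  (mT n.+1 _) (fun x => mulr_ge0 (E0 n.+1 x) (T0 n _ x)) (T0 n.+1 p)
  step0 (integral_trunc_pow n.+1 N0).
have sum1 := ge0_integral_lin2 p0 pB0 (measurable_funM (mE n.+1) (mT n.+1 _))
  (mT n _) (fun x => mulr_ge0 (E0 n.+1 x) (T0 n.+1 _ x)) (T0 n p)
  step1 (integral_trunc_pow n N0).
move: sum0 sum1; move: (trunc_pow N n) (trunc_pow N n.+1).
move: (trunc_cross N n) (trunc_cross N n.+1) => a a' b b' sum0 sum1.
rewrite -lee_fin -sum0 -sum1.
apply: ge0_le_integral => //.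
- by move=> x _; rewrite lee_fin addr_ge0 ?mulr_ge0.
- apply/measurable_EFinP; apply: measurable_funD; apply: measurable_funM => //.
  exact: measurable_funM.
- apply/measurable_EFinP; apply: measurable_funD; apply: measurable_funM => //.
  exact: measurable_funM.
- move=> x _; rewrite lee_fin; apply: azema_yor_step_trunc => //.
  exact: running_max_ge0.
Qed.

(** Doob's inequality with the initial term f ^ p kept. *)
Lemma trunc_azema_yor N n : f <= N ->
  f `^ p + (p - 1) * trunc_pow N n <= p * trunc_cross N n.
Proof.
move=> fN; have N0 : 0 <= N := le_trans (ltW f0) fN.
elim: n => [|n ih]; last first.
  move: ih (trunc_step n N0); move: (trunc_pow N n) (trunc_pow N n.+1).
  by move: (trunc_cross N n) (trunc_cross N n.+1) => a b u v; lra.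
have T0 x : trunc_max N 0 x = f by rewrite /trunc_max/= Einit; exact/min_idPl.
have -> : trunc_pow N 0 = f `^ p.
  rewrite /trunc_pow; under eq_integral do rewrite T0.
  by rewrite integral_cst// [X in (_ * X)%E](probability_setT mu) mule1.
have -> : trunc_cross N 0 = f `^ p.
  rewrite /trunc_cross; under eq_integral do rewrite T0 mulrC EFinM.
  rewrite ge0_integralZl_EFin//; last 3 first.
  - by move=> x _; rewrite lee_fin.
  - exact/measurable_EFinP.
  - exact: powR_ge0.
  by rewrite phi_int -EFinM/= mulrC mulr_powRB1// ltW.
lra.
Qed.

(** The constant produced by Young's inequality when half of the term
    (p - 1) * B is absorbed; it is uniform in N, n and phi. *)
Definition doob_const := 2 * p * ((p - 1) / (2 * p)) `^ (1 - p) / (p - 1).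

Lemma trunc_pow_le N n : f <= N -> trunc_pow N n <= doob_const * F.
Proof.
move=> fN; have N0 : 0 <= N := le_trans (ltW f0) fN.
pose e := (p - 1) / (2 * p).
have e0 : 0 < e by rewrite divr_gt0// mulr_gt0.
have mphip : measurable_fun setT (fun x => phi x `^ p).
  exact: (measurableT_comp (measurable_powR p) mphi).
have cross : trunc_cross N n <= e * trunc_pow N n + e `^ (1 - p) * F.
  rewrite -lee_fin -integral_trunc_cross//.
  rewrite -(ge0_integral_lin2 (ltW e0) (powR_ge0 e (1 - p))
    (measurable_trunc_max_powR _ _ _) mphip _ _ (integral_trunc_pow n N0)
    phi_int_p); last 2 first.
  - by move=> x; exact: powR_ge0.
  - by move=> x; exact: powR_ge0.
  apply: ge0_le_integral => //.
  - by move=> x _; rewrite lee_fin mulr_ge0 ?powR_ge0.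
  - apply/measurable_EFinP; apply: measurable_funM => //.
    exact: measurable_trunc_max_powR.
  - apply/measurable_EFinP.
    by apply: measurable_funD; apply: measurable_funM => //;
      exact: measurable_trunc_max_powR.
  - by move=> x _; rewrite lee_fin; apply: powR_young; rewrite ?trunc_max_ge0.
have := trunc_azema_yor n fN; have := powR_ge0 f p.
have : p * trunc_cross N n <= p * (e * trunc_pow N n + e `^ (1 - p) * F).
  by rewrite ler_wpM2l// ltW.
have -> : p * (e * trunc_pow N n + e `^ (1 - p) * F) =
    (p - 1) / 2 * trunc_pow N n + (p - 1) / 2 * (doob_const * F).
  by rewrite /doob_const -/e /e; field; rewrite !gt_eqF.
move=> h1 h2 h3.
have : (p - 1) / 2 * trunc_pow N n <= (p - 1) / 2 * (doob_const * F) by lra.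
by rewrite ler_pM2l// divr_gt0.
Qed.

(** M is the supremum of the martingale.  Truncating the n-th running maximum at
    height n gives one increasing sequence of bounded functions with limit M. *)
Variable M : X -> \bar R.
Hypothesis Msup :
  forall x, M x = ereal_sup (range (fun n => (E n x)%:E)).

Let Z n x := trunc_max n%:R n x.

Let Z_ge0 n x : 0 <= Z n x.
Proof. by apply: trunc_max_ge0. Qed.

Let mZ n r : measurable_fun setT (fun x => Z n x `^ r).
Proof. exact: measurable_trunc_max_powR. Qed.

Let Z_homo x : nondecreasing_seq (Z ^~ x).
Proof.
move=> m n mn; rewrite /Z /trunc_max le_min !ge_min (running_max_homo E x mn).
by rewrite ler_nat mn orbT.
Qed.

Lemma supremum_ge n x : ((E n x)%:E <= M x)%E.
Proof. by rewrite Msup; apply: ereal_sup_ubound; exists n. Qed.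

Lemma supremum_ge_init x : (f%:E <= M x)%E.
Proof. by rewrite -(Einit x) supremum_ge. Qed.

Lemma measurable_supremum : measurable_fun setT M.
Proof.
have -> : M = fun x => esups (fun n => (E n x)%:E) 0.
  apply/funext => x; rewrite Msup /esups/= /sdrop; congr ereal_sup.
  by apply/seteqP; split=> _ [n _ <-]; exists n.
apply: measurable_fun_esups => n; apply/measurable_EFinP.
exact: measurable_determined (midx n) (Eidx (m := n)).
Qed.

Let Z_le_supremum n x : M x \is a fin_num -> Z n x <= fine (M x).
Proof.
move=> Mfin; rewrite /Z /trunc_max ge_min running_max_le// => k.
by rewrite -lee_fin fineK// supremum_ge.
Qed.

Let cvg_Z x : M x \is a fin_num -> Z n x @[n --> \oo] --> fine (M x).
Proof.
move=> Mfin; apply/cvgrPdist_le => /= e e0.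
have [k Ek] : exists k, fine (M x) - e < E k x.
  apply: contrapT => /forallNP Ek.
  have : (M x <= (fine (M x) - e)%:E)%E.
    rewrite [leLHS]Msup; apply: ge_ereal_sup => _ [n _ <-].
    rewrite lee_fin leNgt.
    by apply/negP; exact: Ek.
  by rewrite -{1}(fineK Mfin) lee_fin; lra.
near=> n.
have kn : (k <= n)%N by near: n; exists k.
have Mn : fine (M x) <= n%:R by near: n; exact: nbhs_infty_ger.
have ZM := Z_le_supremum n Mfin.
rewrite ger0_norm ?subr_ge0// lerBlDr -lerBlDl.
rewrite /Z /trunc_max le_min; apply/andP; split; last by lra.
apply: le_trans (running_max_homo E x kn).
exact: le_trans (ltW Ek) (running_max_ge E k x).
Unshelve. all: by end_near. Qed.

Let S x : \bar R := limn (fun n => (Z n x `^ p)%:E).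

Let Zp_homo x : nondecreasing_seq (fun n => (Z n x `^ p)%:E).
Proof.
move=> m n mn; rewrite lee_fin; apply: powR_le => //; first exact: ltW.
exact: Z_homo.
Qed.

Let S_fin x : M x \is a fin_num -> S x = (fine (M x) `^ p)%:E.
Proof.
move=> Mfin; apply/cvg_lim => //; apply: cvg_EFin; first exact: nearW.
have fM : f <= fine (M x) by rewrite -lee_fin fineK// supremum_ge_init.
have cp := @continuous_powR R p _ (lt_le_trans f0 fM).
exact: cvg_comp (cvg_Z Mfin) cp.
Qed.

(** If the powers of the truncated maxima stay bounded, then so do the maxima,
    because the truncation level n eventually exceeds the bound. *)
Let S_lty x : (S x < +oo)%E -> M x \is a fin_num.
Proof.
move=> Soo; rewrite fin_real// (lt_le_trans _ (supremum_ge_init x)) ?ltNyr//=.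
have S0 : (0 <= S x)%E.
  apply: lime_ge; first exact: ereal_nondecreasing_is_cvgn.
  by apply: nearW => n; rewrite lee_fin powR_ge0.
pose s := fine (S x); have sE : S x = s%:E by rewrite fineK// ge0_fin_numE.
have Zs n : Z n x <= s `^ p^-1.
  rewrite -[leLHS]powRr1//; rewrite -(@mulfV _ p) ?gt_eqF// powRrM.
  apply: powR_le; rewrite ?powR_ge0 ?invr_ge0 ?(ltW p_gt0)//.
  rewrite -lee_fin -sE /S.
  have /cvg_lim -> // := ereal_nondecreasing_cvgn (@Zp_homo x).
  by apply: ereal_sup_ubound; exists n.
rewrite Msup; apply: (@le_lt_trans _ _ (s `^ p^-1)%:E); last exact: ltry.
apply: ge_ereal_sup => _ [k _ <-]; rewrite lee_fin.
near \oo => n.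
have kn : (k <= n)%N by near: n; exists k.
have sn : s `^ p^-1 < n%:R by near: n; exact: nbhs_infty_gtr.
have := Zs n; rewrite /Z /trunc_max ge_min [X in _ || X]leNgt sn orbF.
apply: le_trans; apply: le_trans (running_max_homo E x kn).
exact: running_max_ge.
Unshelve. all: by end_near. Qed.

Let cvg_int_S : (\int[mu]_x (Z n x `^ p)%:E @[n --> \oo] --> \int[mu]_x S x)%E.
Proof.
apply: cvg_monotone_convergence => //.
- by move=> n; exact/measurable_EFinP.
- by move=> n x _; rewrite lee_fin powR_ge0.
Qed.

Let int_S_le : (\int[mu]_x S x <= (doob_const * F)%:E)%E.
Proof.
apply: cvge_le cvg_int_S; near=> n.
have fn : f <= n%:R by near: n; exact: nbhs_infty_ger.
rewrite integral_trunc_pow// lee_fin.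
exact: trunc_pow_le.
Unshelve. all: by end_near. Qed.

Let mS : measurable_fun setT S.
Proof.
apply: (@emeasurable_fun_cvg _ _ _ setT (fun n x => (Z n x `^ p)%:E)).
  by move=> n; exact/measurable_EFinP.
by move=> x _; exact: ereal_nondecreasing_is_cvgn.
Qed.

Let S_ge0 x : (0 <= S x)%E.
Proof.
apply: lime_ge; first exact: ereal_nondecreasing_is_cvgn.
by apply: nearW => n; rewrite lee_fin powR_ge0.
Qed.

(** By monotone convergence the limit S of the powers has a finite integral, and
    S is infinite wherever M is. *)
Lemma supremum_ae_fin : {ae mu, forall x, M x \is a fin_num}.
Proof.
have iS : mu.-integrable setT S.
  apply/integrableP; split => //.
  under eq_integral do rewrite gee0_abs//.
  exact: le_lt_trans int_S_le (ltry _).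
have := integrable_ae measurableT iS; apply: filterS => x /(_ I) Sfin.
by apply: S_lty; rewrite -ge0_fin_numE.
Qed.

Let m_fine_M r : measurable_fun setT (fun x => fine (M x) `^ r).
Proof.
apply: (measurableT_comp (measurable_powR r)).
exact: measurableT_comp measurable_supremum.
Qed.

(** The truncated inequality passes to the limit: the integrals of Z n ^ p
    converge monotonically, and those of phi (Z n)^(p-1) stay below the integral
    A, which is finite by Young's inequality. *)
Lemma doob_supremum : exists A B : R,
  [/\ (\int[mu]_x (phi x * fine (M x) `^ (p - 1))%:E = A%:E)%E,
      (\int[mu]_x (fine (M x) `^ p)%:E = B%:E)%E,
      B <= doob_const * F & f `^ p + (p - 1) * B <= p * A].
Proof.
have intS : (\int[mu]_x S x = \int[mu]_x (fine (M x) `^ p)%:E)%E.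
  apply: ge0_ae_eq_integral => //.
  - exact/measurable_EFinP.
  - by move=> x _; rewrite lee_fin powR_ge0.
  - by apply: filterS supremum_ae_fin => x Mfin _; exact: S_fin.
have intB : (\int[mu]_x (fine (M x) `^ p)%:E \is a fin_num)%E.
  rewrite -intS ge0_fin_numE ?(le_lt_trans int_S_le) ?ltry//.
  exact: integral_ge0.
have mphip : measurable_fun setT (fun x => phi x `^ p).
  exact: (measurableT_comp (measurable_powR p) mphi).
have mcross : measurable_fun setT (fun x => phi x * fine (M x) `^ (p - 1)).
  exact: measurable_funM.
have M0 x : 0 <= fine (M x).
  by apply: fine_ge0; apply: le_trans (supremum_ge_init x); rewrite lee_fin ltW.
have intA : (\int[mu]_x (phi x * fine (M x) `^ (p - 1))%:E \is a fin_num)%E.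
  rewrite ge0_fin_numE; last first.
    by apply: integral_ge0 => x _; rewrite lee_fin mulr_ge0 ?powR_ge0.
  have young := ge0_integral_lin2 ler01 (powR_ge0 1 (1 - p)) (m_fine_M p)
    mphip (fun x => powR_ge0 _ _) (fun x => powR_ge0 _ _) (esym (fineK intB))
    phi_int_p.
  have := ltry
    (1 * fine (\int[mu]_x (fine (M x) `^ p)%:E)%E + 1 `^ (1 - p) * F).
  rewrite -young; apply: le_lt_trans.
  apply: ge0_le_integral => //.
  - by move=> x _; rewrite lee_fin mulr_ge0 ?powR_ge0.
  - exact/measurable_EFinP.
  - apply/measurable_EFinP.
    by apply: measurable_funD; apply: measurable_funM.
  - by move=> x _; rewrite lee_fin; exact: powR_young.
exists (fine (\int[mu]_x (phi x * fine (M x) `^ (p - 1))%:E)).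
exists (fine (\int[mu]_x (fine (M x) `^ p)%:E)).
rewrite !fineK//; split => //.
  by rewrite -lee_fin fineK// -intS.
set B := fine _; set A := fine _.
suff : B <= (p * A - f `^ p) / (p - 1).
  by rewrite ler_pdivlMr// lerBrDl [B * _]mulrC.
rewrite -lee_fin fineK// -intS; apply: cvge_le cvg_int_S; near=> n.
have fn : f <= n%:R by near: n; exact: nbhs_infty_ger.
have n0 : 0 <= n%:R :> R by [].
rewrite integral_trunc_pow// lee_fin.
rewrite ler_pdivlMr// mulrC lerBrDl.
apply: le_trans (trunc_azema_yor n fn) _.
have cross_le : (\int[mu]_x (phi x * Z n x `^ (p - 1))%:E <=
    \int[mu]_x (phi x * fine (M x) `^ (p - 1))%:E)%E.
  apply: ae_ge0_le_integral => //.
  - by move=> x _; rewrite lee_fin mulr_ge0 ?powR_ge0.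
  - by apply/measurable_EFinP; apply: measurable_funM => //; exact: mZ.
  - by move=> x _; rewrite lee_fin mulr_ge0 ?powR_ge0.
  - exact/measurable_EFinP.
  - apply: filterS supremum_ae_fin => x Mfin _; rewrite lee_fin ler_wpM2l//.
    apply: powR_le; [exact: ltW|exact: trunc_max_ge0|].
    exact: Z_le_supremum.
have cross_fin : (\int[mu]_x (phi x * Z n x `^ (p - 1))%:E)%E \is a fin_num.
  by rewrite [X in X \is a _](integral_trunc_cross n n0).
rewrite (ler_pM2l p_gt0); exact: (fine_le cross_fin intA cross_le).
Unshelve. all: by end_near. Qed.

End doob.

(** * Trees as filtrations *)

Lemma partition_index (X : Type) (P : set (set X)) : countable P ->
  (forall x, exists2 I, P I & I x) ->
  (forall I J x, P I -> P J -> I x -> J x -> I = J) ->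
  exists g : X -> nat, forall I x, P I -> I x -> atom g x = I.
Proof.
move=> /countable_injP[e einj] cover disj.
have /choice[c cP] : forall x, exists I, P I /\ I x.
  by move=> x; have [I PI Ix] := cover x; exists I.
have cE I x : P I -> I x -> c x = I.
  by move=> PI Ix; have [Pc cx] := cP x; exact: disj Pc PI cx Ix.
exists (e \o c) => I x PI Ix; rewrite /comp (cE _ _ PI Ix).
apply/seteqP; split=> [y /= ecy|y Iy] /=; last by rewrite (cE _ _ PI Iy).
have [Pc cy] := cP y.
by rewrite -(einj _ _ (mem_set Pc) (mem_set PI) ecy).
Qed.

Section tree_levels_theory.
Context (R : realType) (d : measure_display) (X : measurableType d).
Variables (mu : {measure set X -> \bar R}) (T : set (set X)).
Variable C : set X -> set (set X).
Hypothesis TC : tree_children mu T C.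

Lemma tree_level_in m I : tree_level C m I -> T I.
Proof. by move=> mI; rewrite (tree_levels TC); exists m. Qed.

Lemma tree_level_cover m x : exists2 I, tree_level C m I & I x.
Proof.
elim: m => [|m [I mI Ix]] /=; first by exists setT.
move: Ix; rewrite -{1}(children_cover TC (tree_level_in mI)) => -[J IJ Jx].
by exists J => //; exists I.
Qed.

Lemma tree_level_parent m I : tree_level C m.+1 I ->
  exists J, [/\ tree_level C m J, C J I & I `<=` J].
Proof.
move=> [J mJ JI]; exists J; split => // x Ix.
by rewrite -(children_cover TC (tree_level_in mJ)); exists I.
Qed.

Lemma tree_level_disjoint m I J x :
  tree_level C m I -> tree_level C m J -> I x -> J x -> I = J.
Proof.
elim: m I J => [|m ih] I J; first by move=> /= -> ->.
move=> /tree_level_parent[I' [mI' CI II']] /tree_level_parent[J' [mJ' CJ JJ']].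
move=> Ix Jx; have I'J' := ih _ _ mI' mJ' (II' _ Ix) (JJ' _ Jx).
rewrite -{}I'J' in CJ.
apply: (children_disjoint TC (tree_level_in mI')) => //.
by exists x.
Qed.

Lemma tree_level_countable m : countable (tree_level C m).
Proof.
elim: m => [|m ih] /=; first exact: countable1.
apply: bigcup_countable => // I mI.
exact: children_countable TC _ (tree_level_in mI).
Qed.

End tree_levels_theory.

(** What remains of a tree once its levels are encoded by index functions:
    refining countable partitions whose atoms are the members of T, with mesh
    tending to 0. *)
Record tree_filtration (R : realType) (d : measure_display)
    (X : measurableType d) (mu : {measure set X -> \bar R}) (T : set (set X))
    (idx : nat -> X -> nat) : Prop := TreeFiltration {
  filtration_measurable : forall m, measurable_fun setT (idx m) ;
  filtration_refine : forall m, determined_by (idx m.+1) (idx m) ;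
  filtration_init : forall x, atom (idx 0%N) x = setT ;
  filtration_tree : forall m x, T (atom (idx m) x) ;
  filtration_atom : forall I x, T I -> I x ->
    exists m, I = atom (idx m) x ;
  filtration_mesh : forall e : R, 0 < e ->
    exists m, forall x, (mu (atom (idx m) x) < e%:E)%E }.

Lemma tree_filtration_exists (R : realType) (d : measure_display)
    (X : measurableType d) (mu : probability X R) (T : set (set X)) :
  is_tree mu T -> exists idx, tree_filtration mu T idx.
Proof.
move=> T_tree; have [C TC] := tree_has_children T_tree.
have /choice[idx idxE] : forall m, exists g : X -> nat,
    forall I x, tree_level C m I -> I x -> atom g x = I.
  move=> m; apply: partition_index; first exact: tree_level_countable TC m.
  - by move=> x; exact: tree_level_cover TC m x.
  - by move=> I J x; exact: tree_level_disjoint TC m I J x.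
have level m x : tree_level C m (atom (idx m) x).
  by have [I mI Ix] := tree_level_cover TC m x; rewrite (idxE m I x).
have matom m x : measurable (atom (idx m) x).
  exact: tree_measurable T_tree _ (tree_level_in TC (level m x)).
exists idx; split.
- move=> m _ Y mY; rewrite setTI.
  have -> : idx m @^-1` Y = \bigcup_(k in Y) (idx m @^-1` [set k]).
    by apply/seteqP; split=> [x Yx|x [k Yk /= ->//]]; exists (idx m x).
  apply: bigcup_measurable => k _.
  have [[x <-//]|nk] := pselect (exists x, idx m x = k).
  suff -> : idx m @^-1` [set k] = set0 by [].
  by apply/seteqP; split=> // x /= xk; apply: nk; exists x.
- move=> m x y xy; have [J [mJ _ sub]] := tree_level_parent TC (level m.+1 x).
  have Jx : J x by exact: sub.
  have Jy : J y by apply: sub => /=.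
  by move: Jy; rewrite -(idxE m J x mJ Jx).
- by move=> x; exact: idxE.
- by move=> m x; have := tree_level_in TC (level m x).
- move=> I x; rewrite {1}(tree_levels TC) => -[m _ mI] Ix.
  by exists m; rewrite (idxE m I x).
- move=> e e0; have e0' : (0 < e%:E)%E by rewrite lte_fin.
  have /(_ _ (nbhs_open_ereal_lt e0')) := tree_mesh TC.
  move=> [m _ /(_ m (leqnn _)) /= mm]; exists m => x.
  by apply: le_lt_trans mm; apply: ereal_sup_ubound;
    exists (atom (idx m) x).
Qed.

(** * The maximal function of a tree *)

Lemma average_mulK (R : realType) (d : measure_display) (X : measurableType d)
    (mu : {measure set X -> \bar R}) (phi : X -> R) (I : set X) :
  measurable I -> (0 < mu I)%E -> mu I \is a fin_num ->
  mu.-integrable I (EFin \o phi) ->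
  (\int[mu]_(y in I) (phi y)%:E = (fine (average mu phi I))%:E * mu I)%E /\
  (average mu phi I = (fine (average mu phi I))%:E)%E.
Proof.
move=> mI mu0 mu_fin iphi; rewrite /average.
have := integrable_fin_num mI iphi; rewrite [X in X \is a _]/=.
move: mu0 mu_fin; move: (mu I) (\int[mu]_(y in I) (phi y)%:E)%E.
move=> [m| |] [s| |] //; rewrite lte_fin => m0 _ _.
by rewrite inver gt_eqF// -!EFinM/= mulrAC mulVf ?gt_eqF// mul1r.
Qed.

Section maximal_function.
Context (R : realType) (d : measure_display) (X : measurableType d).
Variables (mu : probability X R) (T : set (set X)) (idx : nat -> X -> nat).
Variable (phi : X -> R).
Hypotheses (T_tree : is_tree mu T) (filt : tree_filtration mu T idx)
  (phi0 : forall x, 0 <= phi x) (phi_L1 : mu.-integrable setT (EFin \o phi)).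

Let E m x := fine (average mu phi (atom (idx m) x)).

Let mphi : measurable_fun setT phi.
Proof. by apply/measurable_EFinP; exact: measurable_int phi_L1. Qed.

Let tree_fin I : T I -> mu I \is a fin_num.
Proof.
by move=> TI; apply: fin_num_measure; exact: tree_measurable T_tree _ TI.
Qed.

Lemma tree_average I : T I ->
  (\int[mu]_(y in I) (phi y)%:E = (fine (average mu phi I))%:E * mu I)%E /\
  (average mu phi I = (fine (average mu phi I))%:E)%E.
Proof.
move=> TI; have mI := tree_measurable T_tree TI.
apply: average_mulK => //; first exact: tree_gt0 T_tree _ TI.
  exact: tree_fin.
by apply: integrableS phi_L1.
Qed.

Lemma average_ge0 m x : 0 <= E m x.
Proof.
apply: fine_ge0; rewrite /average mule_ge0 ?inve_ge0//.
by apply: integral_ge0 => y _; rewrite lee_fin.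
Qed.

Lemma maximalE x :
  maximal mu T phi x = ereal_sup (range (fun n => (E n x)%:E)).
Proof.
have -> : maximal mu T phi x =
    ereal_sup [set average mu phi I | I in [set I | T I /\ I x]].
  rewrite /maximal; congr ereal_sup; apply/seteqP.
  have avE I : average mu (fun y => `|phi y|%R) I = average mu phi I.
    by congr (_ * _)%E; apply: eq_integral => y _; rewrite ger0_norm.
  by split=> _ [I TI <-]; exists I; rewrite ?avE.
congr ereal_sup; apply/seteqP; split=> [_ [I [TI Ix] <-]|_ [m _ <-]].
  have [m Im] := filtration_atom filt TI Ix.
  by exists m => //; rewrite /E -Im -(tree_average TI).2.
have Tm := filtration_tree filt m x.
by exists (atom (idx m) x) => //; rewrite -(tree_average Tm).2.
Qed.

(** At a point of differentiation phi is a limit of averages over sets of the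
    tree, and the mesh condition provides arbitrarily small such sets. *)
Lemma le_maximal_ae :
  {ae mu, forall x, ((phi x)%:E <= maximal mu T phi x)%E}.
Proof.
have := tree_differentiates T_tree phi_L1; apply: filterS => x diff.
apply/lee_addgt0Pr => e e0; have [delta delta0 close] := diff e e0.
have [m mesh] := filtration_mesh filt delta0.
have Tm := filtration_tree filt m x.
have := close _ Tm erefl (mesh x); rewrite (tree_average Tm).2 -EFinB lte_fin.
have : ((E m x)%:E <= maximal mu T phi x)%E.
  by rewrite maximalE; apply: ereal_sup_ubound; exists m.
move=> EM; rewrite ltr_norml => /andP[close' _].
apply: le_trans (leeD2r _ EM); rewrite -EFinD lee_fin.
by move: close'; rewrite /E; lra.
Qed.

Variables (p f F : R).
Hypotheses (p1 : 1 < p) (f0 : 0 < f)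
  (phi_int : (\int[mu]_x (phi x)%:E = f%:E)%E)
  (phi_int_p : (\int[mu]_x ((phi x) `^ p)%:E = F%:E)%E).

Let Einit x : E 0 x = f.
Proof.
rewrite /E (filtration_init filt) /average phi_int.
by rewrite [X in (X^-1)%E](probability_setT mu) inve1 mul1e.
Qed.

Let Eidx m : determined_by (idx m) (E m).
Proof. by move=> x y; rewrite /E => ->. Qed.

Let Ephi m x : (\int[mu]_(y in atom (idx m) x) (phi y)%:E =
    (E m x)%:E * mu (atom (idx m) x))%E.
Proof. exact: (tree_average (filtration_tree filt m x)).1. Qed.

Lemma measurable_maximal : measurable_fun setT (maximal mu T phi).
Proof.
exact: (measurable_supremum (filtration_measurable filt) Eidx maximalE).
Qed.

Lemma maximal_ge_mean x : (f%:E <= maximal mu T phi x)%E.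
Proof. exact: (supremum_ge_init Einit maximalE). Qed.

Lemma maximal_ae_fin : {ae mu, forall x, maximal mu T phi x \is a fin_num}.
Proof.
exact: (supremum_ae_fin (filtration_measurable filt) (filtration_refine filt)
  Eidx average_ge0 Einit mphi phi0 Ephi p1 f0 phi_int phi_int_p maximalE).
Qed.

Lemma doob_maximal : exists A B : R,
  [/\ (\int[mu]_x (phi x * fine (maximal mu T phi x) `^ (p - 1))%:E = A%:E)%E,
      (\int[mu]_x (fine (maximal mu T phi x) `^ p)%:E = B%:E)%E,
      B <= doob_const p * F & f `^ p + (p - 1) * B <= p * A].
Proof.
exact: (doob_supremum (filtration_measurable filt) (filtration_refine filt)
  Eidx average_ge0 Einit mphi phi0 Ephi p1 f0 phi_int phi_int_p maximalE).
Qed.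

End maximal_function.

(** * Homogeneity *)

(** All integrands are homogeneous of degree p in (s, m), hence of the form
    m ^ p times a function of u = z * s / m. *)
Lemma powR_homogeneous (R : realType) (p a z s m : R) :
  0 <= z -> 0 <= s -> 0 < m ->
  (z * s / m) `^ a * m `^ p = z `^ a * (s `^ a * m `^ (p - a)).
Proof.
move=> z0 s0 m0.
rewrite !powRM ?mulr_ge0 ?invr_ge0 ?(ltW m0)// -!mulrA; congr (_ * (_ * _)).
rewrite -powR_inv1 ?(ltW m0)// -powRrM mulN1r.
by rewrite -powRD ?(gt_eqF m0) ?implybT// addrC.
Qed.

Lemma normB_powR (R : realType) (p z s m : R) : 0 < m ->
  `|m - z * s| `^ p = `|z * s / m - 1| `^ p * m `^ p.
Proof.
move=> m0; rewrite -powRM ?(ltW m0)//; congr (_ `^ _).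
rewrite -[X in _ = _ * X](gtr0_norm m0) -normrM mulrBl mul1r divfK ?gt_eqF//.
by rewrite distrC.
Qed.

Section pointwise_estimates.
Context (R : realType).
Variables (p q z s m e C : R).
Hypotheses (p1 : 1 < p) (z1 : 1 <= z) (m0 : 0 < m) (s0 : 0 <= s) (sm : s <= m)
  (C0 : 0 <= C).

Let u := z * s / m.

Let u_itv : 0 <= u <= z.
Proof.
have z0 : 0 <= z by exact: le_trans z1.
rewrite /u divr_ge0 ?mulr_ge0 ?(ltW m0)//=.
by rewrite ler_pdivrMr// ler_wpM2l.
Qed.

Let mp0 : 0 <= m `^ p. Proof. exact: powR_ge0. Qed.

Let uE a : u `^ a * m `^ p = z `^ a * (s `^ a * m `^ (p - a)).
Proof. by apply: powR_homogeneous => //; exact: le_trans z1. Qed.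

Let uE1 : u * m `^ p = z * (s * m `^ (p - 1)).
Proof.
have p0 : 0 < p by exact: lt_trans p1.
rewrite -(mulr_powRB1 (ltW m0) p0) /u mulrA divfK ?gt_eqF//.
by rewrite mulrA.
Qed.

Let uEp : u `^ p * m `^ p = z `^ p * s `^ p.
Proof. by rewrite uE subrr powRr0 mulr1. Qed.

(** The one-variable inequality at u, multiplied by m ^ p. *)
Lemma distance_le_deficit :
  (forall u, 0 <= u <= z ->
    `|u - 1| `^ p <= e + C * (u `^ q - 1 - q * (u - 1))) ->
  `|m - z * s| `^ p + C * q * z * (s * m `^ (p - 1)) <=
  (e + C * (q - 1)) * m `^ p + C * z `^ q * (s `^ q * m `^ (p - q)).
Proof.
move=> /(_ u u_itv) h.
have := ler_wpM2r mp0 h.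
rewrite normB_powR// -/u.
have -> : C * q * z * (s * m `^ (p - 1)) = C * q * (u * m `^ p).
  by rewrite uE1; ring.
have -> : C * z `^ q * (s `^ q * m `^ (p - q)) = C * (u `^ q * m `^ p).
  by rewrite uE; ring.
lra.
Qed.

Lemma deficit_le_distance (D : R) :
  (forall u, 0 <= u <= z ->
    `|p * u `^ q - D - (p - D) * u `^ p| <= e + C * `|u - 1| `^ p) ->
  p * z `^ q * (s `^ q * m `^ (p - q)) <=
    (D + e) * m `^ p + (p - D) * z `^ p * s `^ p + C * `|m - z * s| `^ p /\
  D * m `^ p + (p - D) * z `^ p * s `^ p <=
    p * z `^ q * (s `^ q * m `^ (p - q)) + e * m `^ p
    + C * `|m - z * s| `^ p.
Proof.
move=> /(_ u u_itv); rewrite ler_norml => /andP[lo up].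
have := ler_wpM2r mp0 lo; have := ler_wpM2r mp0 up.
rewrite normB_powR// -/u -!(mulrA p) -!uE -!(mulrA (p - D)) -!uEp.
by move=> up' lo'; split; lra.
Qed.

Lemma distance_le_sup : `|m - z * s| `^ p <= z `^ p * m `^ p.
Proof.
have p0 : 0 <= p by apply: ltW; exact: lt_trans p1.
have z0 : 0 <= z by exact: le_trans z1.
rewrite -powRM ?(ltW m0)//; apply: powR_le => //.
have h1 : z * s <= z * m by rewrite ler_wpM2l.
have h2 : m <= z * m by rewrite ler_peMl ?(ltW m0).
have h3 : 0 <= z * s by exact: mulr_ge0.
rewrite ler_norml; apply/andP; split.
  by move: h1 h2 h3 m0; lra.
by move: h1 h2 h3 m0; lra.
Qed.

Lemma mixed_power_le : 0 <= q -> s `^ q * m `^ (p - q) <= m `^ p.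
Proof.
move=> q0; have -> : m `^ p = m `^ q * m `^ (p - q).
  by rewrite -powRD ?subrKC// (gt_eqF m0) implybT.
by rewrite ler_wpM2r ?powR_ge0// powR_le.
Qed.

End pointwise_estimates.

(** * Deficit and distance *)

(** Bundling a nonnegative function with the finite value of its integral turns
    integration of pointwise inequalities into arithmetic of real numbers. *)
Definition nnintegral (R : realType) (d : measure_display)
    (X : measurableType d) (mu : {measure set X -> \bar R}) (u : X -> R)
    (U : R) : Prop :=
  [/\ measurable_fun setT u, forall x, 0 <= u x &
      (\int[mu]_x (u x)%:E = U%:E)%E].

Section nnintegral_theory.
Context (R : realType) (d : measure_display) (X : measurableType d).
Variable mu : {measure set X -> \bar R}.

Lemma nnintegral_ge0 (u : X -> R) (U : R) : nnintegral mu u U -> 0 <= U.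
Proof.
move=> [_ u0 iu]; rewrite -lee_fin -iu.
by apply: integral_ge0 => x _; rewrite lee_fin.
Qed.

Lemma nnintegralZ (a : R) (u : X -> R) (U : R) : 0 <= a ->
  nnintegral mu u U -> nnintegral mu (fun x => a * u x) (a * U).
Proof.
move=> a0 [mu_ u0 iu]; split.
- exact: measurable_funM.
- by move=> x; rewrite mulr_ge0.
- under eq_integral do rewrite EFinM.
  rewrite ge0_integralZl_EFin ?iu//; first by move=> x _; rewrite lee_fin.
  exact/measurable_EFinP.
Qed.

Lemma nnintegralD (a b : R) (u v : X -> R) (U V : R) : 0 <= a -> 0 <= b ->
  nnintegral mu u U -> nnintegral mu v V ->
  nnintegral mu (fun x => a * u x + b * v x) (a * U + b * V).
Proof.
move=> a0 b0 [mu_ u0 iu] [mv v0 iv]; split.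
- by apply: measurable_funD; exact: measurable_funM.
- by move=> x; rewrite addr_ge0 ?mulr_ge0.
- exact: ge0_integral_lin2.
Qed.

Lemma nnintegral_le (u v : X -> R) (U V : R) :
  nnintegral mu u U -> nnintegral mu v V ->
  {ae mu, forall x, u x <= v x} -> U <= V.
Proof.
move=> [mu_ u0 iu] [mv v0 iv] uv; rewrite -lee_fin -iu -iv.
apply: ae_ge0_le_integral => //.
- by move=> x _; rewrite lee_fin.
- exact/measurable_EFinP.
- by move=> x _; rewrite lee_fin.
- exact/measurable_EFinP.
- by apply: filterS uv => x uvx _; rewrite lee_fin.
Qed.

Lemma nnintegral_dominated (u v : X -> R) (V : R) :
  measurable_fun setT u -> (forall x, 0 <= u x) -> nnintegral mu v V ->
  {ae mu, forall x, u x <= v x} -> exists U, nnintegral mu u U.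
Proof.
move=> mu_ u0 [mv v0 iv] uv; exists (fine (\int[mu]_x (u x)%:E)%E).
split => //; rewrite fineK// ge0_fin_numE; last first.
  by apply: integral_ge0 => x _; rewrite lee_fin.
apply: le_lt_trans (ltry V); rewrite -iv.
apply: ae_ge0_le_integral => //.
- by move=> x _; rewrite lee_fin.
- exact/measurable_EFinP.
- by move=> x _; rewrite lee_fin.
- exact/measurable_EFinP.
- by apply: filterS uv => x uvx _; rewrite lee_fin.
Qed.

End nnintegral_theory.

Definition deficit (R : realType) (d : measure_display) (X : measurableType d)
    (mu : {measure set X -> \bar R}) (T : set (set X)) (p q f beta : R)
    (phi : X -> R) : \bar R :=
  ((- (q * (beta + 1) / ((p - 1) * q * beta + (p - q))) * f `^ p)%:E
    + (p * (beta + 1) `^ q / ((p - 1) * q * beta + (p - q)))%:E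
      * (\int[mu]_x (((phi x) `^ q)%:E * maximal mu T phi x `^ (p - q)))
    - \int[mu]_x (maximal mu T phi x `^ p))%E.

(** It vanishes exactly for the eigenfunctions M phi = (beta + 1) phi of the
    maximal operator. *)
Definition eigen_distance (R : realType) (d : measure_display)
    (X : measurableType d) (mu : {measure set X -> \bar R}) (T : set (set X))
    (p beta : R) (phi : X -> R) : \bar R :=
  (\int[mu]_x (`|maximal mu T phi x - ((beta + 1) * phi x)%:E| `^ p))%E.

Section extremal_estimates.
Context (R : realType) (d : measure_display) (X : measurableType d).
Variables (mu : probability X R) (T : set (set X)) (p q f F beta : R).
Variable (phi : X -> R).
Hypotheses (T_tree : is_tree mu T)
  (p_gt1 : 1 < p) (q_gt1 : 1 < q) (q_lt_p : q < p) (f_gt0 : 0 < f)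
  (beta_ge0 : 0 <= beta) (beta_le : (p - 1) * beta <= 1)
  (f_F : f `^ p = (beta + 1) `^ (p - 1) * (1 - (p - 1) * beta) * F)
  (phi_ge0 : forall x, 0 <= phi x)
  (phi_L1 : mu.-integrable setT (EFin \o phi))
  (phi_int : (\int[mu]_x (phi x)%:E = f%:E)%E)
  (phi_int_p : (\int[mu]_x ((phi x) `^ p)%:E = F%:E)%E).

Let z := beta + 1.
Let D := (p - 1) * q * beta + (p - q).
Let K := doob_const p * F.

Let p_gt0 : 0 < p. Proof. exact: lt_trans p_gt1. Qed.
Let q_gt0 : 0 < q. Proof. exact: lt_trans q_gt1. Qed.
Let pB1_gt0 : 0 < p - 1. Proof. by rewrite subr_gt0. Qed.
Let qB1_gt0 : 0 < q - 1. Proof. by rewrite subr_gt0. Qed.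
Let z_ge1 : 1 <= z. Proof. by rewrite lerDr. Qed.
Let z_ge0 : 0 <= z. Proof. exact: le_trans z_ge1. Qed.
Let D_gt0 : 0 < D.
Proof. by rewrite ltr_wpDl ?subr_gt0// !mulr_ge0// ltW. Qed.
Let DE : p - D = q * (1 - (p - 1) * beta).
Proof. by rewrite /D; ring. Qed.
Let pD_ge0 : 0 <= p - D.
Proof. by rewrite DE mulr_ge0 ?subr_ge0// ltW. Qed.

Let e := fine (deficit mu T p q f beta phi).
Let dist := fine (eigen_distance mu T p beta phi).

(** The pair (eps, C) ranges over all constants for which the one-variable
    inequalities hold, so that one choice serves a whole sequence of functions.
    The first estimate integrates the inequality for |u - 1| ^ p and eliminates
    the integral of phi M^(p-1) by Doob's inequality; the second integrates both
    signs of the inequality and uses the equation satisfied by beta. *)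
Lemma deficit_estimates :
  [/\ deficit mu T p q f beta phi \is a fin_num,
    eigen_distance mu T p beta phi \is a fin_num,
    forall eps C, 0 <= eps -> 0 <= C ->
      (forall u, 0 <= u <= z ->
         `|u - 1| `^ p <= eps + C * (u `^ q - 1 - q * (u - 1))) ->
      `|dist| <= eps * K + C * (D / p) * `|e| &
    forall eps C, 0 <= eps -> 0 <= C ->
      (forall u, 0 <= u <= z ->
         `|p * u `^ q - D - (p - D) * u `^ p| <= eps + C * `|u - 1| `^ p) ->
      D * `|e| <= eps * K + C * `|dist| ].
Proof.
have [idx filt] := tree_filtration_exists T_tree.
set M := maximal mu T phi; pose m x := fine (M x).
have mphi : measurable_fun setT phi.
  by apply/measurable_EFinP; exact: measurable_int phi_L1.
have mM : measurable_fun setT M.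
  exact: measurable_maximal T_tree filt phi_ge0 phi_L1.
have mm : measurable_fun setT m by exact: measurableT_comp mM.
have Mm : {ae mu, forall x, M x = (m x)%:E}.
  have := maximal_ae_fin T_tree filt phi_ge0 phi_L1 p_gt1 f_gt0 phi_int
    phi_int_p.
  by apply: filterS => x /fineK.
have m_gt0 : {ae mu, forall x, 0 < m x /\ phi x <= m x}.
  have := le_maximal_ae T_tree filt phi_ge0 phi_L1.
  apply: filterS2 Mm => x Mx phiM; split; rewrite -?lte_fin -?lee_fin -Mx//.
  apply: lt_le_trans (maximal_ge_mean T_tree filt phi_ge0 phi_L1 phi_int x).
  by rewrite lte_fin.
have [A [B [iA iB BK azema]]] :=
  doob_maximal T_tree filt phi_ge0 phi_L1 p_gt1 f_gt0 phi_int phi_int_p.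
have mpow (g : X -> R) r : measurable_fun setT g ->
    measurable_fun setT (fun x => g x `^ r).
  by move=> mg; exact: measurableT_comp (measurable_powR r) mg.
have nnA : nnintegral mu (fun x => phi x * m x `^ (p - 1)) A.
  split => //; first by apply: measurable_funM => //; exact: mpow.
  by move=> x; rewrite mulr_ge0 ?powR_ge0.
have nnB : nnintegral mu (fun x => m x `^ p) B.
  by split => //; [exact: mpow|move=> x; exact: powR_ge0].
have nnF : nnintegral mu (fun x => phi x `^ p) F.
  by split => //; [exact: mpow|move=> x; exact: powR_ge0].
have [J nnJ] : exists J,
    nnintegral mu (fun x => phi x `^ q * m x `^ (p - q)) J.
  apply: nnintegral_dominated nnB _.
  - by apply: measurable_funM; exact: mpow.
  - by move=> x; rewrite mulr_ge0 ?powR_ge0.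
  - apply: filterS m_gt0 => x [mx0 phim].
    by apply: mixed_power_le => //; exact: ltW.
have [G nnG] : exists G, nnintegral mu (fun x => `|m x - z * phi x| `^ p) G.
  apply: nnintegral_dominated (nnintegralZ (powR_ge0 z p) nnB) _.
  - apply: mpow; apply: measurableT_comp => //; apply: measurable_funB => //.
    exact: measurable_funM.
  - by move=> x; exact: powR_ge0.
  - by apply: filterS m_gt0 => x [mx0 phim]; exact: distance_le_sup.
pose e' := - (q * z / D) * f `^ p + p * z `^ q / D * J - B.
have deficitE : deficit mu T p q f beta phi = e'%:E.
  rewrite /deficit -/M.
  have -> : (\int[mu]_x ((phi x `^ q)%:E * M x `^ (p - q)) = J%:E)%E.
    have [mJ J0 <-] := nnJ; apply: ae_eq_integral => //.
    + apply: emeasurable_funM; first by apply/measurable_EFinP; exact: mpow.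
      exact: measurableT_comp (measurable_poweR _) mM.
    + exact/measurable_EFinP.
    + by apply: filterS Mm => x -> _ /=; rewrite -EFinM.
  have -> : (\int[mu]_x (M x `^ p) = B%:E)%E.
    have [mB B0 <-] := nnB; apply: ae_eq_integral => //.
    + exact: measurableT_comp (measurable_poweR _) mM.
    + exact/measurable_EFinP.
    + by apply: filterS Mm => x -> _.
  by [].
have distE : eigen_distance mu T p beta phi = G%:E.
  rewrite /eigen_distance -/M.
  have [mG G0 <-] := nnG; apply: ae_eq_integral => //.
  + apply: (measurableT_comp (measurable_poweR _)).
    apply: measurableT_comp => //; apply: emeasurable_funB => //.
    by apply/measurable_EFinP; exact: measurable_funM.
  + exact/measurable_EFinP.
  + by apply: filterS Mm => x -> _ /=.
have -> : e = e' by rewrite /e deficitE.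
have -> : dist = G by rewrite /dist distE.
have G0 := nnintegral_ge0 nnG; rewrite (ger0_norm G0).
split; [by rewrite deficitE|by rewrite distE| |].
- move=> eps C eps0 C0 H.
  have nnL := nnintegralD ler01
    (mulr_ge0 (mulr_ge0 C0 (ltW q_gt0)) z_ge0) nnG nnA.
  have nnR := nnintegralD (addr_ge0 eps0 (mulr_ge0 C0 (ltW qB1_gt0)))
    (mulr_ge0 C0 (powR_ge0 z q)) nnB nnJ.
  have {nnL nnR} LR := nnintegral_le nnL nnR _.
  have {}LR : G + C * q * z * A <= (eps + C * (q - 1)) * B + C * z `^ q * J.
    rewrite -[G]mul1r; apply: LR; apply: filterS m_gt0 => x [mx0 phim].
    by rewrite mul1r; exact: distance_le_deficit.
  have EB : eps * B <= eps * K by rewrite ler_wpM2l.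
  have CA : C * q * z / p * (f `^ p + (p - 1) * B) <= C * q * z / p * (p * A).
    by rewrite ler_wpM2l// divr_ge0 ?mulr_ge0// ltW.
  have Ee : C * (D / p) * e' <= C * (D / p) * `|e'|.
    by rewrite ler_wpM2l ?ler_norm// mulr_ge0// divr_ge0// ltW.
  have CE : C * (D / p) * e' = C * z `^ q * J + C * (q - 1) * B
      - C * q * z / p * (f `^ p + (p - 1) * B).
    rewrite /e' -[RHS]addrA.
    have -> : C * (q - 1) * B - C * q * z / p * (f `^ p + (p - 1) * B) =
       - C * D / p * B - C * q * z / p * f `^ p.
      by rewrite /D /z; field; rewrite gt_eqF.
    by field; rewrite !gt_eqF.
  have pA : C * q * z / p * (p * A) = C * q * z * A by field; rewrite gt_eqF.
  lra.
- move=> eps C eps0 C0 H.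
  have EB : eps * B <= eps * K by rewrite ler_wpM2l.
  have zp0 : 0 <= (p - D) * z `^ p by rewrite mulr_ge0// powR_ge0.
  have pz0 : 0 <= p * z `^ q by rewrite mulr_ge0 ?powR_ge0// ltW.
  have nn1 := nnintegralD ler01 C0
    (nnintegralD (addr_ge0 (ltW D_gt0) eps0) zp0 nnB nnF) nnG.
  have nn2 := nnintegralZ pz0 nnJ.
  have nn3 := nnintegralD (ltW D_gt0) zp0 nnB nnF.
  have nn4 := nnintegralD ler01 C0 (nnintegralD pz0 eps0 nnJ nnB) nnG.
  have up : p * z `^ q * J <= (D + eps) * B + (p - D) * z `^ p * F + C * G.
    have := nnintegral_le nn2 nn1; rewrite mul1r; apply.
    apply: filterS m_gt0 => x [mx0 phim]; rewrite mul1r.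
    by have [] := deficit_le_distance z_ge1 mx0 (phi_ge0 x) phim H.
  have lo : D * B + (p - D) * z `^ p * F <= p * z `^ q * J + eps * B + C * G.
    have := nnintegral_le nn3 nn4; rewrite mul1r; apply.
    apply: filterS m_gt0 => x [mx0 phim]; rewrite mul1r.
    by have [] := deficit_le_distance z_ge1 mx0 (phi_ge0 x) phim H.
  have zF : (p - D) * z `^ p * F = q * z * f `^ p.
    by rewrite f_F DE -(mulr_powRB1 z_ge0 p_gt0) /z; ring.
  have De : D * e' = p * z `^ q * J - q * z * f `^ p - D * B.
    by rewrite /e'; field; rewrite gt_eqF.
  have -> : D * `|e'| = `|D * e'| by rewrite normrM gtr0_norm.
  by rewrite De ler_norml; apply/andP; split; lra.
Qed.

End extremal_estimates.

(** * The function omega *)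

Lemma Hfun_factor (R : realType) (p z : R) : 0 < p -> 0 <= z ->
  Hfun p z = z `^ (p - 1) * (1 - (p - 1) * (z - 1)).
Proof. by move=> p0 z0; rewrite /Hfun -(mulr_powRB1 z0 p0); ring. Qed.

(** H_p is continuous with values 1 and 0 at the ends of its interval, hence
    onto [0, 1] by the intermediate value theorem, and its right inverse returns
    points of that interval. *)
Lemma omegaP (R : realType) (p y : R) : 1 < p -> 0 <= y <= 1 ->
  1 <= omega p y <= p / (p - 1) /\ Hfun p (omega p y) = y.
Proof.
move=> p1 y01.
have p0 : 0 < p by exact: lt_trans p1.
have pB0 : 0 < p - 1 by rewrite subr_gt0.
have le1c : 1 <= p / (p - 1) by rewrite ler_pdivlMr// mul1r; lra.
have Hcont : {within `[1, p / (p - 1)], continuous (Hfun p)}.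
  apply: continuous_in_subspaceT => z /set_mem/=.
  rewrite in_itv/= => /andP[z1 _].
  have z0 : 0 < z by exact: lt_le_trans z1.
  by apply: cvgD; apply: cvgM; try exact: cvg_cst; exact: continuous_powR.
have H1 : Hfun p 1 = 1 by rewrite Hfun_factor// powR1; ring.
have Hc : Hfun p (p / (p - 1)) = 0.
  rewrite Hfun_factor//; last exact: le_trans le1c.
  rewrite (_ : 1 - _ = 0) ?mulr0//; field; rewrite gt_eqF//.
have Hsurj : set_surj `[1, p / (p - 1)] `[0, 1] (Hfun p).
  move=> v /=; rewrite in_itv/= => v01.
  have [|c cI cv] := IVT le1c Hcont (v := v).
    by rewrite H1 Hc minElt maxElt ltr10.
  by exists c.
have yI : (`[0, 1]%classic : set R) y by rewrite /= in_itv.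
split; last by rewrite /omega (surjpK _ Hsurj)// mem_set.
suff : (`[1, p / (p - 1)]%classic : set R) (omega p y) by rewrite /= in_itv.
by apply: (surjpinv_image_sub Hsurj); exists y.
Qed.

Lemma cvge0_fine (R : realType) (u : nat -> \bar R) :
  (forall n, u n \is a fin_num) ->
  (u n @[n --> \oo] --> 0%E) <-> (fine (u n) @[n --> \oo] --> (0 : R)).
Proof.
move=> ufin; split=> [|u0]; first exact: fine_cvg.
by apply: cvg_EFin => //; exact: nearW.
Qed.

(** * The equivalence *)

Theorem theorem2 (R : realType) (d : measure_display) (X : measurableType d)
  (mu : probability X R) (T : set (set X)) (p q f F beta : R)
  (phi : nat -> X -> R)
  (mu_non_atomic : non_atomic mu) (T_tree : is_tree mu T)
  (p_gt1 : 1 < p) (q_gt1 : 1 < q) (q_lt_p : q < p)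
  (fp_gt0 : 0 < f `^ p) (fp_le_F : f `^ p <= F)
  (phi_ge0 : forall n x, 0 <= phi n x)
  (phi_L1 : forall n, mu.-integrable setT (EFin \o phi n))
  (phi_good : forall n, tree_good mu T (phi n))
  (phi_int : forall n, (\int[mu]_x (phi n x)%:E = f%:E)%E)
  (phi_int_p : forall n, (\int[mu]_x ((phi n x) `^ p)%:E = F%:E)%E)
  (beta_def : beta + 1 = omega p (f `^ p / F)) :
  (((- (q * (beta + 1) / ((p - 1) * q * beta + (p - q))) * f `^ p)%:E
    + (p * (beta + 1) `^ q / ((p - 1) * q * beta + (p - q)))%:E
      * (\int[mu]_x (((phi n x) `^ q)%:E * maximal mu T (phi n) x `^ (p - q)))
    - \int[mu]_x (maximal mu T (phi n) x `^ p))%E @[n --> \oo] --> 0%E)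
  <->
  ((\int[mu]_x (`|maximal mu T (phi n) x - ((beta + 1) * phi n x)%:E| `^ p))%E
    @[n --> \oo] --> 0%E).
Proof.
have p_gt0 : 0 < p by exact: lt_trans p_gt1.
have q_gt0 : 0 < q by exact: lt_trans q_gt1.
have pB1_gt0 : 0 < p - 1 by rewrite subr_gt0.
have F_gt0 : 0 < F by exact: lt_le_trans fp_le_F.
have f_gt0 : 0 < f.
  rewrite lt_neqAle; apply/andP; split.
    by apply: contraTneq fp_gt0 => <-; rewrite powR0 ?ltxx// gt_eqF.
  rewrite -lee_fin -(phi_int 0%N); apply: integral_ge0 => x _.
  by rewrite lee_fin.
have y01 : 0 <= f `^ p / F <= 1.
  by rewrite divr_ge0 ?(ltW fp_gt0) ?(ltW F_gt0)//= ler_pdivrMr// mul1r.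
have [/andP[z_ge1 z_le] Hz] := omegaP p_gt1 y01.
rewrite -beta_def in z_ge1 z_le Hz.
have beta_ge0 : 0 <= beta by rewrite -(lerD2r 1) add0r.
have beta_le : (p - 1) * beta <= 1.
  by move: z_le; rewrite ler_pdivlMr//; lra.
have z_ge0 : 0 <= beta + 1 by exact: le_trans z_ge1.
have f_F : f `^ p = (beta + 1) `^ (p - 1) * (1 - (p - 1) * beta) * F.
  by move: Hz; rewrite Hfun_factor// addrK => ->; rewrite divfK// gt_eqF.
set D := (p - 1) * q * beta + (p - q).
have D_gt0 : 0 < D.
  by rewrite ltr_wpDl ?subr_gt0// !mulr_ge0// ltW.
set z := beta + 1; pose K := doob_const p * F.
pose e n := fine (deficit mu T p q f beta (phi n)).
pose dist n := fine (eigen_distance mu T p beta (phi n)).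
have est n := deficit_estimates T_tree p_gt1 q_gt1 q_lt_p f_gt0 beta_ge0
  beta_le f_F (phi_ge0 n) (phi_L1 n) (phi_int n) (phi_int_p n).
have K_gt0 : 0 < K.
  have e_gt0 : 0 < (p - 1) / (2 * p) by rewrite divr_gt0// mulr_gt0.
  by rewrite /K mulr_gt0// /doob_const divr_gt0// !mulr_gt0// powR_gt0.
have K_neq0 : K != 0 by rewrite gt_eqF.
have powR_le_z u (a : R) : 0 <= a -> 0 <= u <= z -> u `^ a <= z `^ a.
  by move=> a0 /andP[u0 uz]; exact: powR_le.
apply: (iff_trans (@cvge0_fine _ (fun n => deficit mu T p q f beta (phi n)) _)).
  by move=> n; have [] := est n.
apply: iff_trans (iff_sym (@cvge0_fine _
  (fun n => eigen_distance mu T p beta (phi n)) _)); last first.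
  by move=> n; have [] := est n.
split=> [e0|dist0].
- apply: (cvg0_dominated e0) => eps eps0.
  (* The division by K offsets the bound K on the integral of M ^ p. *)
  have eps'0 : 0 < eps / K by rewrite divr_gt0.
  have [||u uz|u uz|h h0|C C0 HC] := @dominated_off_one R
    (fun u => `|u - 1| `^ p) (fun u => u `^ q - 1 - q * (u - 1)) z (z `^ p)
    _ _ _ _ _ _ eps'0.
  + exact: continuous_normB1_powR.
  + by rewrite subrr normr0 powR0// gt_eqF.
  + rewrite ger0_norm ?powR_ge0//; apply: powR_le => //; first exact: ltW.
    by move: uz z_ge1 => /andP[]; rewrite -/z ler_norml; lra.
  + by move: uz => /andP[u0 _]; have := bernoulli_powR q_gt1 u0; lra.
  + exact: bernoulli_gap_off_one.
  exists (C * (D / p)); first by rewrite mulr_ge0// divr_ge0// ltW.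
  move=> n; have [_ _ + _] := est n.
  move=> /(_ _ C (ltW eps'0) C0) h; apply: le_trans (h _) _ => [u uz|].
    by have := HC u uz; rewrite ger0_norm ?powR_ge0.
  by rewrite divfK.
- apply: (cvg0_dominated dist0) => eps eps0.
  have eps'0 : 0 < eps * D / K by rewrite divr_gt0// mulr_gt0.
  have [||u uz|u uz|h h0|C C0 HC] := @dominated_off_one R
    (fun u => p * u `^ q - D - (p - D) * u `^ p) (fun u => `|u - 1| `^ p) z
    (p * z `^ q + D + `|p - D| * z `^ p) _ _ _ _ _ _ eps'0.
  + apply: cvgB; [apply: cvgB; last exact: cvg_cst|];
      by apply: cvgM; [exact: cvg_cst|exact: continuous_powR].
  + by rewrite !powR1; ring.
  + apply: le_trans (ler_normB _ _) _.
    rewrite normrM (ger0_norm (powR_ge0 _ _)).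
    apply: lerD; last by rewrite ler_wpM2l// powR_le_z// ltW.
    apply: le_trans (ler_normB _ _) _.
    rewrite normrM (ger0_norm (powR_ge0 _ _)).
    rewrite (gtr0_norm p_gt0) (gtr0_norm D_gt0) lerD2r ler_wpM2l ?(ltW p_gt0)//.
    by rewrite powR_le_z// ltW.
  + exact: powR_ge0.
  + exists (h `^ p) => [|u _ hu]; first exact: powR_gt0.
    by apply: powR_le => //; exact: ltW.
  exists (C / D); first by rewrite divr_ge0// ltW.
  move=> n; have [_ _ _] := est n.
  move=> /(_ _ C (ltW eps'0) C0 HC) h.
  rewrite -(ler_pM2l D_gt0); apply: le_trans h _.
  rewrite divfK// le_eqVlt; apply/orP; left; apply/eqP.
  by field; rewrite gt_eqF.
Qed.
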